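(* For every integer $m\geq 1$, the graph $[m\Gamma(\mathbb{Z}_9)+\Gamma(\mathbb{Z}_4)]\times\Gamma(\mathbb{Z}_9)$ admits a distance antimagic labeling, where $m\Gamma(\mathbb{Z}_9)+\Gamma(\mathbb{Z}_4)$ is the join of $m\Gamma(\mathbb{Z}_9)$ and $\Gamma(\mathbb{Z}_4)$ and $\times$ is the Cartesian product.
   Context: For an integer $n \geq 2$, the zero-divisor graph $\Gamma(\mathbb{Z}_n)$ is the simple graph whose vertex set is the set of nonzero zero-divisors of the ring $\mathbb{Z}_n$, two distinct vertices $u,v$ being adjacent iff $uv \equiv 0 \pmod n$. For a graph $H$ and positive integer $k$, $kH$ denotes the disjoint union of $k$ copies of $H$. For graphs $G,H$, the join $G+H$ is the graph obtained from the disjoint union of $G$ and $H$ by adding every edge between a vertex of $G$ and a vertex of $H$. The Cartesian product $G\times H$ has vertex set $V(G)\times V(H)$, with $(u,v)$ adjacent to $(u',v')$ iff either $u=u'$ and $vv'\in E(H)$, or $v=v'$ and $uu'\in E(G)$. A distance antimagic labeling (DAML) of a graph $G$ with $N$ vertices is a bijection $f:V(G)\to\{1,\dots,N\}$ such that the weights $w(v)=\sum_{u\in N(v)} f(u)$, where $N(v)$ is the open neighbourhood of $v$, are pairwise distinct over all vertices $v$. A graph admits DAML if such a labeling exists. *)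

(* Defs.v *)
From mathcomp Require Import all_boot all_algebra.

Set Implicit Arguments.
Unset Strict Implicit.
Unset Printing Implicit Defensive.

Record sgraph := SGraph {
  vertex :> finType;
  adj : rel vertex;
  adj_sym : symmetric adj;
  adj_irrefl : irreflexive adj
}.

Arguments adj {s} u v.

Section ZeroDivisorGraph.

Variable R : finComNzRingType.

Definition zero_divisor (x : R) : bool :=
  [exists y : R, (y != 0)%R && (x * y == 0)%R].

Definition zdg_vertex : finType := {x : R | (x != 0)%R && zero_divisor x}.

Definition zdg_adj (u v : zdg_vertex) : bool :=
  (u != v) && (val u * val v == 0)%R.

Lemma zdg_adj_sym : symmetric zdg_adj.
Proof. by move=> u v; rewrite /zdg_adj eq_sym GRing.mulrC. Qed.

Lemma zdg_adj_irrefl : irreflexive zdg_adj.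
Proof. by move=> u; rewrite /zdg_adj eqxx. Qed.

Definition zero_divisor_graph : sgraph := SGraph zdg_adj_sym zdg_adj_irrefl.

End ZeroDivisorGraph.

(* Meaningful for 1 < n only: 'Z_0 and 'Z_1 both denote the integers modulo 2. *)
Definition Gamma_Z (n : nat) : sgraph := zero_divisor_graph 'Z_n.

Section GraphOperations.

Variables G H : sgraph.

Definition copies_adj (k : nat) (p q : 'I_k * G) : bool :=
  (p.1 == q.1) && adj p.2 q.2.

Lemma copies_adj_sym k : symmetric (@copies_adj k).
Proof. by move=> p q; rewrite /copies_adj eq_sym adj_sym. Qed.

Lemma copies_adj_irrefl k : irreflexive (@copies_adj k).
Proof. by move=> p; rewrite /copies_adj adj_irrefl andbF. Qed.

Definition copies (k : nat) : sgraph :=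
  SGraph (@copies_adj_sym k) (@copies_adj_irrefl k).

Definition join_adj (p q : G + H) : bool :=
  match p, q with
  | inl u, inl v => adj u v
  | inr u, inr v => adj u v
  | _, _ => true
  end.

Lemma join_adj_sym : symmetric join_adj.
Proof. by move=> [u|u] [v|v] //=; rewrite adj_sym. Qed.

Lemma join_adj_irrefl : irreflexive join_adj.
Proof. by move=> [u|u] /=; rewrite adj_irrefl. Qed.

Definition graph_join : sgraph := SGraph join_adj_sym join_adj_irrefl.

Definition cartesian_adj (p q : G * H) : bool :=
  (p.1 == q.1) && adj p.2 q.2 || (p.2 == q.2) && adj p.1 q.1.

Lemma cartesian_adj_sym : symmetric cartesian_adj.
Proof.
move=> p q; rewrite /cartesian_adj (eq_sym p.1) (eq_sym p.2).
by rewrite (adj_sym p.1) (adj_sym p.2).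
Qed.

Lemma cartesian_adj_irrefl : irreflexive cartesian_adj.
Proof. by move=> p; rewrite /cartesian_adj !adj_irrefl !andbF. Qed.

Definition cartesian_product : sgraph :=
  SGraph cartesian_adj_sym cartesian_adj_irrefl.

End GraphOperations.

Section DistanceAntimagic.

Variable G : sgraph.

Definition weight (f : G -> nat) (v : G) : nat := \sum_(u : G | adj v u) f u.

(* The first two clauses say that f is a bijection from the vertices of G onto
   {1, ..., #|G|}. *)
Definition distance_antimagic_labeling (f : G -> nat) : Prop :=
  [/\ injective f,
      forall k : nat, (exists v : G, f v = k) <-> 1 <= k <= #|G|
    & injective (weight f)].

Definition admits_DAML : Prop :=
  exists f : G -> nat, distance_antimagic_labeling f.

End DistanceAntimagic.

(* Main.v *)
(** The graph Gamma(Z_9) is K_2 and Gamma(Z_4) is K_1, so the product is made of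
    m four-cycles (the i-th copy of K_2 times K_2), indexed by (i, a, b), and of
    an edge whose end (c, b) is joined to every (i, a, b).  Label the i-th cycle
    by 4i+1, ..., 4i+4 so that each pair of opposite vertices receives two
    consecutive numbers, and the edge by 4m+1, 4m+2.  The two cycle neighbours of
    a vertex are opposite, so its weight is 4k+3 plus 4m+1 or 4m+2, where k < 2m
    determines the pair: these numbers are all distinct.  The two layers b = 0, 1
    have the same sum on the cycles, so the weights of (c, b) are the consecutive
    numbers 4m^2+5m+1 and 4m^2+5m+2; they exceed the other weights if m > 1, and
    for m = 1 they are 10 and 11, against 8, 9, 12, 13. *)

Require Import Defs.
From mathcomp Require Import all_boot all_algebra.
From mathcomp Require Import zify.

Set Implicit Arguments.
Unset Strict Implicit.
Unset Printing Implicit Defensive.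

(** * Graph isomorphisms: compatibility with the operations and with labelings *)

Definition graph_iso (G H : sgraph) : Prop :=
  exists2 phi : G -> H, bijective phi & forall u v, adj (phi u) (phi v) = adj u v.

Lemma copies_iso (G H : sgraph) m :
  graph_iso G H -> graph_iso (copies G m) (copies H m).
Proof.
case=> phi [psi phiK psiK] adj_phi.
exists (fun p : copies G m => (p.1, phi p.2) : copies H m).
  by exists (fun p => (p.1, psi p.2)) => -[i x] /=; rewrite ?phiK ?psiK.
by move=> p q; rewrite /adj /= /copies_adj /= adj_phi.
Qed.

Lemma graph_join_iso (G G' H H' : sgraph) :
  graph_iso G G' -> graph_iso H H' ->
  graph_iso (graph_join G H) (graph_join G' H').
Proof.
case=> phi [psi phiK psiK] adj_phi [phi' [psi' phiK' psiK'] adj_phi'].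
exists (fun p : graph_join G H =>
          match p with inl x => inl (phi x) | inr y => inr (phi' y) end
          : graph_join G' H').
  exists (fun p => match p with inl x => inl (psi x) | inr y => inr (psi' y) end).
    by case=> x; rewrite ?phiK ?phiK'.
  by case=> x; rewrite ?psiK ?psiK'.
by case=> u [] v; rewrite /adj /= ?adj_phi ?adj_phi'.
Qed.

Lemma cartesian_product_iso (G G' H H' : sgraph) :
  graph_iso G G' -> graph_iso H H' ->
  graph_iso (cartesian_product G H) (cartesian_product G' H').
Proof.
case=> phi phi_bij adj_phi [phi' phi'_bij adj_phi'].
exists (fun p : cartesian_product G H =>
          (phi p.1, phi' p.2) : cartesian_product G' H').
  case: phi_bij phi'_bij => psi phiK psiK [psi' phiK' psiK'].
  by exists (fun p => (psi p.1, psi' p.2)) => -[x y] /=;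
    rewrite ?phiK ?phiK' ?psiK ?psiK'.
move=> p q; rewrite /adj /= /cartesian_adj /= adj_phi adj_phi'.
by rewrite (bij_eq phi_bij) (bij_eq phi'_bij).
Qed.

(** A labeling pulls back along [phi]: reindexing neighbourhood sums shows that weights are
    preserved. *)
Lemma admits_DAML_iso (G H : sgraph) :
  graph_iso G H -> admits_DAML H -> admits_DAML G.
Proof.
case=> phi phi_bij adj_phi [f [f_inj f_im w_inj]].
have weight_phi v : weight (f \o phi) v = weight f (phi v).
  rewrite /weight (reindex phi) /=; last exact: onW_bij.
  by apply: eq_bigl => u; rewrite adj_phi.
exists (f \o phi); split.
- exact: inj_comp f_inj (bij_inj phi_bij).
- move=> k; rewrite (bij_eq_card phi_bij) -f_im; split=> -[v <-].
    by exists (phi v).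
  by case: phi_bij => psi _ psiK; exists (psi v); rewrite /= psiK.
- by move=> u v; rewrite !weight_phi => /w_inj; exact: bij_inj.
Qed.

(** * Complete graphs, and the zero-divisor graphs of Z_9 and Z_4 *)

Section CompleteGraph.

Variable T : finType.

Definition complete_adj (x y : T) : bool := x != y.

Lemma complete_adj_sym : symmetric complete_adj.
Proof. by move=> x y; rewrite /complete_adj eq_sym. Qed.

Lemma complete_adj_irrefl : irreflexive complete_adj.
Proof. by move=> x; rewrite /complete_adj eqxx. Qed.

Definition complete_graph : sgraph := SGraph complete_adj_sym complete_adj_irrefl.

End CompleteGraph.

Lemma complete_graph_iso (G : sgraph) (T : finType) :
    (forall u v : G, adj u v = (u != v)) -> #|G| = #|T| ->
  graph_iso G (complete_graph T).
Proof.
move=> adjG cardG.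
pose phi (u : G) : T := enum_val (cast_ord cardG (enum_rank u)).
have phi_bij : bijective phi.
  apply: inj_card_bij; last by rewrite cardG.
  by move=> u v /enum_val_inj/cast_ord_inj/enum_rank_inj.
exists phi => // u v.
by rewrite adjG /adj /= /complete_adj (bij_eq phi_bij).
Qed.

Lemma zero_divisor_graph_complete (R : finComNzRingType) (T : finType)
    (s : seq R) :
    (forall x : R, (x != 0)%R && zero_divisor x = (x \in s)) ->
    {in s &, forall x y, (x * y = 0)%R} -> uniq s -> size s = #|T| ->
  graph_iso (zero_divisor_graph R) (complete_graph T).
Proof.
move=> zdE s_mul0 s_uniq s_size; apply: complete_graph_iso => [u v|].
  have inS (w : zero_divisor_graph R) : val w \in s by rewrite -zdE (valP w).
  by rewrite /adj /= /zdg_adj s_mul0 // eqxx andbT.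
by rewrite card_sig (eq_card zdE) -s_size; apply/card_uniqP.
Qed.

Lemma Gamma_Z9_iso : graph_iso (Gamma_Z 9) (complete_graph bool).
Proof.
apply: (@zero_divisor_graph_complete _ _ [:: 3%:R; 6%:R]%R).
- move=> x; apply/idP/idP.
    case/andP=> x0 /existsP[y /andP[y0 /eqP xy]]; move: x0 y0 xy.
    by case: x => -[|[|[|[|[|[|[|[|[|x]]]]]]]]] // ltx;
      case: y => -[|[|[|[|[|[|[|[|[|y]]]]]]]]] // lty _ _ // /(congr1 val).
  by rewrite !inE => /orP[]/eqP->; apply/andP; split=> //;
    (* The element 3 annihilates both 3 and 6 modulo 9. *)
    apply/existsP; exists 3%:R%R; apply/andP; split=> //; apply/eqP/val_inj.
- by move=> x y; rewrite !inE => /orP[]/eqP-> /orP[]/eqP->; apply: val_inj.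
- by [].
- by rewrite card_bool.
Qed.

Lemma Gamma_Z4_iso : graph_iso (Gamma_Z 4) (complete_graph unit).
Proof.
apply: (@zero_divisor_graph_complete _ _ [:: 2%:R]%R).
- move=> x; apply/idP/idP.
    case/andP=> x0 /existsP[y /andP[y0 /eqP xy]]; move: x0 y0 xy.
    by case: x => -[|[|[|[|x]]]] // ltx;
      case: y => -[|[|[|[|y]]]] // lty _ _ // /(congr1 val).
  rewrite !inE => /eqP->; apply/andP; split=> //.
  by apply/existsP; exists 2%:R%R; apply/andP; split=> //; apply/eqP/val_inj.
- by move=> x y; rewrite !inE => /eqP-> /eqP->; apply: val_inj.
- by [].
- by rewrite card_unit.
Qed.

(** Shifted down by one, [f] is an injection into ['I_#|T|], hence a bijection by cardinality. *)
Lemma injective_labels_onto (T : finType) (f : T -> nat) :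
    injective f -> (forall v, 1 <= f v <= #|T|) ->
  forall k, (exists v, f v = k) <-> 1 <= k <= #|T|.
Proof.
move=> f_inj f_bnd k; split=> [[v <-] //|/andP[k_gt0 k_le]].
have f_ltn v : (f v).-1 < #|T| by have := f_bnd v; lia.
have g_bij : bijective (fun v => Ordinal (f_ltn v)).
  apply: inj_card_bij; last by rewrite card_ord.
  by move=> u v [fuv]; apply: f_inj; have := f_bnd u; have := f_bnd v; lia.
have k_ltn : k.-1 < #|T| by lia.
case: g_bij => h _ hK; set v := h (Ordinal k_ltn); exists v.
have fv : (f v).-1 = k.-1 := congr1 val (hK (Ordinal k_ltn)).
by have := f_bnd v; lia.
Qed.

(** * The explicit labeling of the prism over [m] triangles sharing a vertex *)

Section FriendshipPrism.

Variable m : nat.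

Definition friendship_prism : sgraph :=
  cartesian_product
    (graph_join (copies (complete_graph bool) m) (complete_graph unit))
    (complete_graph bool).

Implicit Types v : friendship_prism.

(** Opposite vertices of a cycle share [a (+) b], which selects the pair of labels; [a] selects the
    label within the pair. *)
Definition prism_label v : nat :=
  match v with
  | (inl (i, a), b) => (4 * i + 2 * (a (+) b) + a).+1
  | (inr _, b) => (4 * m + b).+1
  end.

Lemma sum_prism (F : friendship_prism -> nat) :
  \sum_v F v = \sum_(i < m) \sum_(a : bool) \sum_(b : bool) F (inl (i, a), b)
               + \sum_(b : bool) F (inr tt, b).
Proof.
transitivity (\sum_(x : 'I_m * bool + unit) \sum_(b : bool) F (x, b)).
  by rewrite pair_bigA; apply: eq_bigr => -[].
rewrite big_sumType /=; congr (_ + _).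
  by rewrite [RHS]pair_bigA; apply: eq_bigr => -[].
by rewrite (big_pred1 tt) //; case.
Qed.

(** Adjacency in a four-cycle means differing in exactly one coordinate, which is a parity
    condition. *)
Lemma adj_prism_rim (i j : 'I_m) (a b c d : bool) :
  @adj friendship_prism (inl (i, a), b) (inl (j, c), d)
  = (i == j) && (a (+) b (+) c (+) d).
Proof.
have inlE : (inl (i, a) == inl (j, c) :> 'I_m * bool + unit)
            = (i == j) && (a == c) by [].
rewrite /adj /= /cartesian_adj /= inlE /adj /= /copies_adj /adj /= /complete_adj.
by case: (i == j); case: a b c d {inlE} => -[] [] [].
Qed.

Lemma weight_prism_rim (i : 'I_m) (a b : bool) :
  weight prism_label (inl (i, a), b) = 4 * (2 * i + ~~ (a (+) b)) + 4 * m + 4 + b.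
Proof.
rewrite /weight big_mkcond sum_prism (bigD1 i) //.
rewrite [\sum_(j < m | _) _]big1 => [|j /negPf ji].
  rewrite !big_bool !adj_prism_rim eqxx /=.
  by case: a b => -[]; rewrite /adj /= /cartesian_adj /=; lia.
by rewrite !big_bool !adj_prism_rim eq_sym ji.
Qed.

Lemma weight_prism_hub (b : bool) :
  weight prism_label (inr tt, b) = 4 * m ^ 2 + 5 * m + 1 + ~~ b.
Proof.
rewrite /weight big_mkcond sum_prism.
(* In either layer, cycle [i] contributes (4i + 2b + 1) + (4i + 4 - 2b). *)
rewrite (eq_bigr (fun i : 'I_m => 8 * i + 5)) => [|i _]; last first.
  by rewrite !big_bool /adj /= /cartesian_adj /adj /=; case: b => /=; lia.
rewrite big_split -big_distrr /= sum_nat_const card_ord.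
have -> : \sum_(i < m) i = 'C(m, 2) by rewrite -bin2_sum big_mkord.
(* This gives 2 C(m, 2) = m (m - 1), which eliminates the binomial. *)
have := mul_bin_diag m 1; rewrite bin1.
by rewrite !big_bool /adj /= /cartesian_adj /adj /=; case: b => /=; nia.
Qed.

Lemma card_friendship_prism : #|friendship_prism| = 4 * m + 2.
Proof.
by rewrite card_prod card_sum card_prod card_ord card_bool card_unit; lia.
Qed.

Lemma prism_label_inj : injective prism_label.
Proof.
move=> [[[i a]|[]] b] [[[j c]|[]] d] /=; first 1 last.
(* Cycle labels are at most 4m, hub labels at least 4m + 1. *)
- by have := ltn_ord i; case: a b d => -[] []; lia.
- by have := ltn_ord j; case: c b d => -[] []; lia.
- by case: b d => -[] //; lia.
move=> eq_lab; have ij : i = j.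
  by apply: val_inj => /=; move: eq_lab; case: a b c d => -[] [] []; lia.
by rewrite ij in eq_lab *; case: a b c d eq_lab => -[] [] [] //=; lia.
Qed.

Lemma prism_label_bounds v : 1 <= prism_label v <= #|friendship_prism|.
Proof.
rewrite card_friendship_prism; case: v => -[[i a]|[]] b /=.
  by have := ltn_ord i; case: a b => -[] /=; lia.
by case: b; lia.
Qed.

Lemma weight_prism_neq (i : 'I_m) (a b c : bool) :
  weight prism_label (inl (i, a), b) <> weight prism_label (inr tt, c).
Proof.
rewrite weight_prism_rim weight_prism_hub.
have i_lt := ltn_ord i; have [m1|m_neq1] := eqVneq m 1.
  by have -> : m ^ 2 = 1 by [rewrite m1]; case: a b c => -[] [] /=; lia.
(* Here m > 1: cycle weights are at most 12m + 1, hub weights at least 4m^2 + 5m + 1 >= 13m + 1. *)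
by have : 2 * m <= m ^ 2; [nia | case: a b c => -[] [] /=; lia].
Qed.

Lemma weight_prism_inj : injective (weight prism_label).
Proof.
move=> [[[i a]|[]] b] [[[j c]|[]] d].
- rewrite !weight_prism_rim => eq_w; have ij : i = j.
    (* Up to a constant the weight is 8i + r with r < 8, so it determines [i]. *)
    by apply: val_inj => /=; move: eq_w; case: a b c d => -[] [] []; lia.
  by rewrite ij in eq_w *; case: a b c d eq_w => -[] [] [] //=; lia.
- by move/weight_prism_neq.
- by move/esym/weight_prism_neq.
- by rewrite !weight_prism_hub; case: b d => -[] //=; lia.
Qed.

Lemma friendship_prism_admits_DAML : admits_DAML friendship_prism.
Proof.
exists prism_label; split.
- exact: prism_label_inj.
- exact: injective_labels_onto prism_label_inj prism_label_bounds.
- exact: weight_prism_inj.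
Qed.

End FriendshipPrism.

Theorem theorem2p9 (m : nat) (hm : 1 <= m) :
  admits_DAML
    (cartesian_product (graph_join (copies (Gamma_Z 9) m) (Gamma_Z 4))
                       (Gamma_Z 9)).
Proof.
apply: admits_DAML_iso (friendship_prism_admits_DAML m).
apply: cartesian_product_iso Gamma_Z9_iso.
exact: graph_join_iso (copies_iso m Gamma_Z9_iso) Gamma_Z4_iso.
Qed.
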